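(* Let $\overline{A_1A_2A_3}$ be a triangle in the plane over a field not of characteristic two, with green orthocenter $O_g$, green circumcenter $C_g$, green nine-point center $N_g$, and centroid $G$. Then the points $O_g,N_g,G$ and $C_g$ lie on a line, called the green Euler line. Furthermore $N_g$ is the midpoint of $O_g$ and $C_g$, and $$G=\tfrac13 O_g+\tfrac23 C_g=\tfrac13 C_g+\tfrac23 N_g.$$
   Context: A point is an ordered pair $[x,y]$ of field elements. A line is a proportion $\langle a:b:c\rangle$ with $a,b$ not both zero; the point $[x,y]$ lies on it precisely when $ax+by+c=0$. Lines $\langle a_1:b_1:c_1\rangle$ and $\langle a_2:b_2:c_2\rangle$ are green perpendicular when $a_1b_2+b_1a_2=0$. A triangle $\overline{A_1A_2A_3}$ is a set of three distinct non-collinear points. The green altitude from a point $A$ to a line $l$ is the unique line through $A$ green perpendicular to $l$. The green orthocenter of a triangle is the common point of the three green altitudes from its points to the opposite lines. The green perpendicular bisector of a side $\overline{A_iA_j}$ is the green altitude from the midpoint of $A_i$ and $A_j$ to the line $A_iA_j$; the green circumcenter is the common point of the three green perpendicular bisectors. (These common points always exist and are unique.) The green nine-point center of $\overline{A_1A_2A_3}$ is the green circumcenter of the triangle of midpoints of its sides. The centroid $G$ is the intersection of the medians (the lines joining each point of the triangle to the midpoint of the opposite side). Affine combinations of points are taken coordinatewise. *)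

(* Defs.v *)
From HB Require Import structures.
From mathcomp Require Import all_boot all_order all_algebra.
From mathcomp Require Import ring.

Set Implicit Arguments.
Unset Strict Implicit.
Unset Printing Implicit Defensive.

Import GRing.Theory.
Local Open Scope ring_scope.

Definition point (F : fieldType) : Type := (F * F)%type.

Definition affine_comb (F : fieldType) (s : F) (A : point F) (t : F)
    (B : point F) : point F :=
  (s * A.1 + t * B.1, s * A.2 + t * B.2).

Definition midpoint (F : fieldType) (A B : point F) : point F :=
  affine_comb (1 / 2) A (1 / 2) B.

(* Coefficients of the equation a x + b y + c = 0 of a line. *)
Definition coefs (F : fieldType) : Type :=
  {t : F * F * F | (t.1.1 != 0) || (t.1.2 != 0)}.
HB.instance Definition _ (F : fieldType) := Choice.on (coefs F).

Definition ca (F : fieldType) (t : coefs F) : F := (val t).1.1.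
Definition cb (F : fieldType) (t : coefs F) : F := (val t).1.2.
Definition cc (F : fieldType) (t : coefs F) : F := (val t).2.

(* Equality of the proportions a : b : c; see proportionalP. *)
Definition proportional (F : fieldType) (s t : coefs F) : bool :=
  [&& ca s * cb t == ca t * cb s,
      ca s * cc t == ca t * cc s &
      cb s * cc t == cb t * cc s].

Lemma proportionalP (F : fieldType) (s t : coefs F) :
  reflect (exists2 k, k != 0 &
             [/\ ca t = k * ca s, cb t = k * cb s & cc t = k * cc s])
          (proportional s t).
Proof.
apply: (iffP and3P); last first.
  by move=> [k _ [-> -> ->]]; split; apply/eqP; ring.
case: s t => [[[a b] c] /= hs] [[[a' b'] c'] /= ht].
rewrite /ca /cb /cc /= => -[/eqP h1 /eqP h2 /eqP h3].
have [a0|a0] := eqVneq a 0; last first.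
  exists (a' / a); last first.
    by split; rewrite ?divfK // mulrAC -?h1 -?h2 mulrAC divff ?mul1r.
  apply: contraTneq ht => /eqP; rewrite mulf_eq0 invr_eq0 (negPf a0) orbF.
  move=> /eqP a'0; move/eqP: h1; rewrite a'0 mul0r mulf_eq0 (negPf a0) /=.
  by move=> /eqP->; rewrite eqxx.
have b0 : b != 0 by move: hs; rewrite a0 eqxx.
have a'0 : a' = 0.
  by move/esym/eqP: h1; rewrite a0 mul0r mulf_eq0 (negPf b0) orbF => /eqP.
exists (b' / b).
  by rewrite mulf_neq0 ?invr_eq0 //; move: ht; rewrite a'0 eqxx.
by split; rewrite ?a0 ?a'0 ?mulr0 ?divfK // mulrAC -h3 mulrAC divff ?mul1r.
Qed.

Lemma proportional_refl (F : fieldType) : reflexive (@proportional F).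
Proof. by move=> s; rewrite /proportional !eqxx. Qed.

Lemma proportional_sym (F : fieldType) : symmetric (@proportional F).
Proof.
move=> s t; rewrite /proportional (eq_sym (ca s * cb t)).
by rewrite (eq_sym (ca s * cc t)) (eq_sym (cb s * cc t)).
Qed.

Lemma proportional_trans (F : fieldType) : transitive (@proportional F).
Proof.
move=> t s u /proportionalP[k k0 [e1 e2 e3]] /proportionalP[l l0 [f1 f2 f3]].
apply/proportionalP; exists (l * k); first exact: mulf_neq0.
by rewrite f1 f2 f3 e1 e2 e3 !mulrA.
Qed.

Canonical proportional_equiv (F : fieldType) :=
  EquivRel (@proportional F) (@proportional_refl F) (@proportional_sym F)
           (@proportional_trans F).

Definition line (F : fieldType) : Type :=
  {eq_quot (@proportional F)}%qT.
HB.instance Definition _ (F : fieldType) :=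
  EqQuotient.on (line F).
HB.instance Definition _ (F : fieldType) := Choice.on (line F).

Definition mkline (F : fieldType) (a b c : F) (h : (a != 0) || (b != 0)) :
  line F := (\pi_(line F) (exist _ (a, b, c) h : coefs F))%qT.

(* on_line and green_perp do not depend on the representative chosen by repr:
   see on_mkline and green_perp_mkline. *)
Definition on_line (F : fieldType) (X : point F) (l : line F) : Prop :=
  ca (repr l) * X.1 + cb (repr l) * X.2 + cc (repr l) = 0.

Definition green_perp (F : fieldType) (l m : line F) : Prop :=
  ca (repr l) * cb (repr m) + cb (repr l) * ca (repr m) = 0.

Definition line_through (F : fieldType) (A B : point F) (l : line F) : Prop :=
  on_line A l /\ on_line B l.

Definition triangle (F : fieldType) (A1 A2 A3 : point F) : Prop :=
  [/\ A1 <> A2, A1 <> A3, A2 <> A3 &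
      ~ exists l : line F, [/\ on_line A1 l, on_line A2 l & on_line A3 l]].

(* m is the green altitude from A to l; it exists and is unique by
   green_altitude_unique. *)
Definition green_altitude (F : fieldType) (A : point F) (l m : line F) : Prop :=
  on_line A m /\ green_perp m l.

Definition on_green_altitude (F : fieldType) (A P Q X : point F) : Prop :=
  exists l m : line F,
    [/\ line_through P Q l, green_altitude A l m & on_line X m].

Definition is_green_orthocenter (F : fieldType) (A1 A2 A3 X : point F) : Prop :=
  [/\ on_green_altitude A1 A2 A3 X,
      on_green_altitude A2 A1 A3 X &
      on_green_altitude A3 A1 A2 X].

Definition on_green_bisector (F : fieldType) (P Q X : point F) : Prop :=
  on_green_altitude (midpoint P Q) P Q X.

Definition is_green_circumcenter (F : fieldType) (A1 A2 A3 X : point F) :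
  Prop :=
  [/\ on_green_bisector A2 A3 X,
      on_green_bisector A1 A3 X &
      on_green_bisector A1 A2 X].

Definition is_green_nine_point_center (F : fieldType) (A1 A2 A3 X : point F) :
  Prop :=
  is_green_circumcenter (midpoint A2 A3) (midpoint A1 A3) (midpoint A1 A2) X.

Definition on_median (F : fieldType) (A P Q X : point F) : Prop :=
  exists2 m : line F, line_through A (midpoint P Q) m & on_line X m.

(* In characteristic three the medians are distinct and parallel, so that no
   point is a centroid. *)
Definition is_centroid (F : fieldType) (A1 A2 A3 X : point F) : Prop :=
  [/\ on_median A1 A2 A3 X, on_median A2 A1 A3 X & on_median A3 A1 A2 X].

Lemma repr_mkline (F : fieldType) (a b c : F) (h : (a != 0) || (b != 0)) :
  exists2 k, k != 0 & [/\ ca (repr (mkline c h)) = k * a,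
    cb (repr (mkline c h)) = k * b & cc (repr (mkline c h)) = k * c].
Proof.
apply/(@proportionalP F (exist _ (a, b, c) h) (repr (mkline c h))).
by apply/eqmodP; rewrite reprK.
Qed.

Lemma mklineP (F : fieldType) (l : line F) :
  exists a b c (h : (a != 0) || (b != 0)), l = mkline c h.
Proof.
rewrite -(reprK l); case: (repr l) => [[[a b] c] h].
by exists a, b, c, h.
Qed.

Lemma mkline_eq (F : fieldType) (a b c a' b' c' : F)
    (h : (a != 0) || (b != 0)) (h' : (a' != 0) || (b' != 0)) :
  mkline c h = mkline c' h' <->
  exists2 k, k != 0 & [/\ a' = k * a, b' = k * b & c' = k * c].
Proof.
split=> [/eqmodP/proportionalP|kP] //; by apply/eqmodP/proportionalP.
Qed.

Lemma on_mkline (F : fieldType) (X : point F) (a b c : F)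
    (h : (a != 0) || (b != 0)) :
  on_line X (mkline c h) <-> a * X.1 + b * X.2 + c = 0.
Proof.
rewrite /on_line; have [k k0 [-> -> ->]] := repr_mkline c h.
rewrite -!mulrA -!mulrDr; split=> [/eqP|->]; last by rewrite mulr0.
by rewrite mulf_eq0 (negPf k0) => /eqP.
Qed.

Lemma green_perp_mkline (F : fieldType) (a b c a' b' c' : F)
    (h : (a != 0) || (b != 0)) (h' : (a' != 0) || (b' != 0)) :
  green_perp (mkline c h) (mkline c' h') <-> a * b' + b * a' = 0.
Proof.
rewrite /green_perp; have [k k0 [-> -> _]] := repr_mkline c h.
have [k' k'0 [-> -> _]] := repr_mkline c' h'.
rewrite (mulrACA k a) (mulrACA k b) -mulrDr.
split=> [/eqP|->]; last by rewrite mulr0.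
by rewrite !mulf_eq0 (negPf k0) (negPf k'0) => /eqP.
Qed.

Lemma green_altitude_unique (F : fieldType) (A : point F) (l : line F) :
  exists! m : line F, green_altitude A l m.
Proof.
have [a [b [c [h ->]]]] := mklineP l.
have h1 : (a != 0) || (- b != 0) by rewrite oppr_eq0.
exists (mkline (b * A.2 - a * A.1) h1); split.
  by split; [apply/on_mkline; ring | apply/green_perp_mkline; ring].
move=> m; have [a' [b' [c' [h' ->]]]] := mklineP m.
move=> [/on_mkline e1 /green_perp_mkline e2].
have {e1}-> : c' = - (a' * A.1 + b' * A.2).
  by apply/eqP; rewrite -addr_eq0 addrC e1.
apply/eqmodP/and3P; rewrite /ca /cb /cc /=.
have e : a * b' = a' * - b.
  by move/eqP: e2; rewrite addr_eq0 => /eqP e2; ring: e2.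
split; apply/eqP => //; ring: e.
Qed.

Lemma line_through_unique (F : fieldType) (A B : point F) :
  A <> B -> exists! l : line F, line_through A B l.
Proof.
move: A B => [x1 y1] [x2 y2] neq.
have h : (y1 - y2 != 0) || (x2 - x1 != 0).
  rewrite !subr_eq0; apply: contra_notT neq; rewrite negb_or !negbK.
  by move=> /andP[/eqP-> /eqP->].
exists (mkline (x1 * y2 - x2 * y1) h); split.
  by split; apply/on_mkline => /=; ring.
move=> l; have [a [b [c [h' ->]]]] := mklineP l.
move=> [/on_mkline /= e1 /on_mkline /= e2].
have {e1}e1 : c = - (a * x1 + b * y1).
  by apply/eqP; rewrite -addr_eq0 addrC e1.
have e : (y1 - y2) * b = a * (x2 - x1).
  by apply/eqP; rewrite -subr_eq0 -oppr_eq0 -e2 e1; apply/eqP; ring.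
apply/eqmodP/and3P; rewrite /ca /cb /cc /= e1; split; apply/eqP => //.
  transitivity (- (y1 - y2) * a * x1 - (y1 - y2) * b * y1); first by ring.
  by rewrite e; ring.
transitivity (- (a * (x2 - x1)) * x1 - (x2 - x1) * b * y1); first by ring.
by rewrite -e; ring.
Qed.

Lemma on_green_altitudeP (F : fieldType) (A P Q X : point F) : P <> Q ->
  on_green_altitude A P Q X <->
  (P.2 - Q.2) * (X.1 - A.1) + (P.1 - Q.1) * (X.2 - A.2) = 0.
Proof.
move=> neq.
have h : (P.2 - Q.2 != 0) || (Q.1 - P.1 != 0).
  rewrite !subr_eq0; apply: contra_notT neq; rewrite negb_or !negbK.
  by case: P Q => [? ?] [? ?] /= /andP[/eqP-> /eqP->].
have h1 : (P.2 - Q.2 != 0) || (P.1 - Q.1 != 0).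
  by rewrite -(oppr_eq0 (P.1 - _)) opprB.
pose l := mkline (P.1 * Q.2 - Q.1 * P.2) h.
have lP : line_through P Q l by split; apply/on_mkline => /=; ring.
pose m := mkline (- ((P.2 - Q.2) * A.1 + (P.1 - Q.1) * A.2)) h1.
have mP : green_altitude A l m.
  by split; [apply/on_mkline; ring | apply/green_perp_mkline; ring].
have mX : on_line X m <->
    (P.2 - Q.2) * (X.1 - A.1) + (P.1 - Q.1) * (X.2 - A.2) = 0.
  by rewrite on_mkline; split=> <-; ring.
split=> [[l' [m' [l'P m'P Xm']]]|eX]; last first.
  by exists l, m; split => //; apply/mX.
have [l0 [_ lu]] := line_through_unique neq.
have [m0 [_ mu]] := green_altitude_unique A l.
by apply/mX; rewrite -(mu m) // (mu m') // -(lu l) // (lu l').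
Qed.

Lemma triangle_det (F : fieldType) (A1 A2 A3 : point F) :
  triangle A1 A2 A3 <->
  (A2.1 - A1.1) * (A3.2 - A1.2) - (A3.1 - A1.1) * (A2.2 - A1.2) != 0.
Proof.
split.
  case=> n12 _ _ ncol; apply: contra_notN ncol => /eqP e.
  have h : (A1.2 - A2.2 != 0) || (A2.1 - A1.1 != 0).
    rewrite !subr_eq0; apply: contra_notT n12; rewrite negb_or !negbK.
    by case: A1 A2 {e} => [? ?] [? ?] /= /andP[/eqP-> /eqP->].
  exists (mkline (A1.1 * A2.2 - A2.1 * A1.2) h).
  by split; apply/on_mkline; [ring | ring | rewrite -e; ring].
move=> D0; split.
- by apply/eqP; apply: contraNneq D0 => ->; apply/eqP; ring.
- by apply/eqP; apply: contraNneq D0 => ->; apply/eqP; ring.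
- by apply/eqP; apply: contraNneq D0 => ->; apply/eqP; ring.
move=> [l]; have [a [b [c [h ->]]]] := mklineP l.
case=> /on_mkline e1 /on_mkline e2 /on_mkline e3.
have f2 : a * (A2.1 - A1.1) + b * (A2.2 - A1.2) = 0.
  transitivity ((a * A2.1 + b * A2.2 + c) - (a * A1.1 + b * A1.2 + c)).
    by ring.
  by rewrite e2 e1 subrr.
have f3 : a * (A3.1 - A1.1) + b * (A3.2 - A1.2) = 0.
  transitivity ((a * A3.1 + b * A3.2 + c) - (a * A1.1 + b * A1.2 + c)).
    by ring.
  by rewrite e3 e1 subrr.
move: h D0; set p := A2.1 - _ in f2 *; set q := A2.2 - _ in f2 *.
set r := A3.1 - _ in f3 *; set s := A3.2 - _ in f3 *.
move=> /orP[] /negPf n0 /negP; apply.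
  have /eqP : a * (p * s - r * q) = 0.
    transitivity ((a * p + b * q) * s - (a * r + b * s) * q); first by ring.
    by rewrite f2 f3 !mul0r subrr.
  by rewrite mulf_eq0 n0.
have /eqP : b * (p * s - r * q) = 0.
  transitivity ((a * r + b * s) * p - (a * p + b * q) * r); first by ring.
  by rewrite f2 f3 !mul0r subrr.
by rewrite mulf_eq0 n0.
Qed.

Lemma linear_system (F : fieldType) (p q r s c d x y : F) :
  p * s - r * q != 0 -> q * x + p * y = c -> s * x + r * y = d ->
  (x, y) = ((p * d - r * c) / (p * s - r * q),
            (s * c - q * d) / (p * s - r * q)).
Proof. by move=> D0 <- <-; congr (_, _); field. Qed.

Lemma green_orthocenterE (F : fieldType) (A1 A2 A3 X : point F) :
  triangle A1 A2 A3 ->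
  let p := A2.1 - A1.1 in let q := A2.2 - A1.2 in
  let r := A3.1 - A1.1 in let s := A3.2 - A1.2 in
  let D := p * s - r * q in
  is_green_orthocenter A1 A2 A3 X <->
  X = (A1.1 + (p * s + r * q) * (p - r) / D,
       A1.2 + (p * s + r * q) * (s - q) / D).
Proof.
move=> T p q r s D; have /triangle_det := T; rewrite -/p -/q -/r -/s -/D => D0.
case: T => n12 n13 n23 _; rewrite /is_green_orthocenter.
split; last first.
  move=> ->; split; apply/on_green_altitudeP => //=;
  by move: D0; rewrite /D /p /q /r /s => D0; field.
case=> _ /(on_green_altitudeP _ _ n13) e2 /(on_green_altitudeP _ _ n12) e3.
have f3 : q * (X.1 - A1.1) + p * (X.2 - A1.2) = (q * r + p * s).
  by rewrite -[RHS]subr0 -e3 /p /q /r /s; ring.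
have f2 : s * (X.1 - A1.1) + r * (X.2 - A1.2) = (s * p + r * q).
  by rewrite -[RHS]subr0 -e2 /p /q /r /s; ring.
have [] := linear_system D0 f3 f2.
move=> /(canRL (subrK _)) eX /(canRL (subrK _)) eY.
by rewrite [LHS]surjective_pairing eX eY; congr (_, _); rewrite -/D; field.
Qed.

Lemma green_circumcenterE (F : fieldType) (A1 A2 A3 X : point F) :
  2 \notin [pchar F] -> triangle A1 A2 A3 ->
  let p := A2.1 - A1.1 in let q := A2.2 - A1.2 in
  let r := A3.1 - A1.1 in let s := A3.2 - A1.2 in
  let D := p * s - r * q in
  is_green_circumcenter A1 A2 A3 X <->
  X = (A1.1 + p * r * (s - q) / D, A1.2 + q * s * (p - r) / D).
Proof.
move=> char2 T p q r s D.
have two : 2%:R != 0 :> F by move: char2; rewrite inE.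
have /triangle_det := T; rewrite -/p -/q -/r -/s -/D => D0.
case: T => n12 n13 n23 _; rewrite /is_green_circumcenter /on_green_bisector.
split; last first.
  move=> ->; split; apply/on_green_altitudeP => //=;
  by move: D0; rewrite /D /p /q /r /s => D0; field; rewrite ?two ?D0.
case=> _ /(on_green_altitudeP _ _ n13) /= e2.
move=> /(on_green_altitudeP _ _ n12) /= e3.
have f3 : q * (X.1 - A1.1) + p * (X.2 - A1.2) = (p * q).
  by rewrite -[RHS]subr0 -e3 /p /q /r /s; field.
have f2 : s * (X.1 - A1.1) + r * (X.2 - A1.2) = (r * s).
  by rewrite -[RHS]subr0 -e2 /p /q /r /s; field.
have [] := linear_system D0 f3 f2.
move=> /(canRL (subrK _)) eX /(canRL (subrK _)) eY.
by rewrite [LHS]surjective_pairing eX eY; congr (_, _); rewrite -/D; field.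
Qed.

Lemma green_orthocenter_unique (F : fieldType) (A1 A2 A3 : point F) :
  triangle A1 A2 A3 -> exists! X : point F, is_green_orthocenter A1 A2 A3 X.
Proof.
by move=> T; eexists; split=> [|X]; rewrite green_orthocenterE.
Qed.

Lemma green_circumcenter_unique (F : fieldType) (A1 A2 A3 : point F) :
  2 \notin [pchar F] -> triangle A1 A2 A3 ->
  exists! X : point F, is_green_circumcenter A1 A2 A3 X.
Proof.
by move=> F2 T; eexists; split=> [|X]; rewrite green_circumcenterE.
Qed.

(* Main.v *)
(** Put A1 at the origin and let (p, q), (r, s) be the other two points and
    D = p s - r q, which is nonzero.  The orthocenter and circumcenter have
    explicit coordinates with denominator D, from which O + 2 C = A1 + A2 + A3;
    the formula for the circumcenter, applied to the medial triangle, gives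
    N = (O + C) / 2.  Subtracting the equations of two medians gives D = 3 e
    for some e, so the existence of a centroid excludes characteristic three,
    and then G = (A1 + A2 + A3) / 3. *)
Require Import Defs.
From mathcomp Require Import all_boot all_order all_algebra.
From mathcomp Require Import ring.

Set Implicit Arguments.
Unset Strict Implicit.

Import GRing.Theory.
Local Open Scope ring_scope.

(** Contrapositive of [triangle_det]: a nonzero determinant would make the points a triangle, which
    no line contains. *)
Lemma collinear_det (F : fieldType) (l : line F) (A B X : point F) :
  on_line A l -> on_line B l -> on_line X l ->
  (B.1 - A.1) * (X.2 - A.2) - (X.1 - A.1) * (B.2 - A.2) = 0.
Proof.
move=> hA hB hX; apply/eqP; apply: contraT => /triangle_det[_ _ _ []].
by exists l.
Qed.

(** A vertical line serves when [A = B]: over some fields the orthocenter and circumcenter can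
    coincide. *)
Lemma line_through_exists (F : fieldType) (A B : point F) :
  exists l : line F, line_through A B l.
Proof.
have [<-|/eqP AB] := eqVneq A B; last first.
  by have [l [hl _]] := line_through_unique AB; exists l.
have h : (1 != 0 :> F) || (0 != 0 :> F) by rewrite oner_eq0.
by exists (mkline (- A.1) h); split; apply/on_mkline; ring.
Qed.

Lemma on_line_affine_comb (F : fieldType) (s t : F) (A B : point F)
    (l : line F) :
  s + t = 1 -> on_line A l -> on_line B l -> on_line (affine_comb s A t B) l.
Proof.
have [a [b [c [h ->]]]] := mklineP l.
move=> st /on_mkline eA /on_mkline eB; apply/on_mkline => /=.
transitivity (s * (a * A.1 + b * A.2 + c) + t * (a * B.1 + b * B.2 + c)
  + (1 - (s + t)) * c); first by ring.
by rewrite eA eB st subrr mulr0 mul0r mulr0 !addr0.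
Qed.

(** The collinearity determinant, doubled to clear the denominators of the midpoint. *)
Lemma on_median_eq (F : fieldType) (A P Q X : point F) :
  2 != 0 :> F -> on_median A P Q X ->
  (P.1 + Q.1 - 2 * A.1) * (X.2 - A.2)
    - (X.1 - A.1) * (P.2 + Q.2 - 2 * A.2) = 0.
Proof.
move=> two [m [hA hM] hX]; have /= e := collinear_det hA hM hX.
by rewrite -[RHS](mulr0 2) -e; field.
Qed.

Lemma centroidE (F : fieldType) (A1 A2 A3 G : point F) :
  2 \notin [pchar F] -> triangle A1 A2 A3 -> is_centroid A1 A2 A3 G ->
  3 != 0 :> F /\
  G = ((A1.1 + A2.1 + A3.1) / 3, (A1.2 + A2.2 + A3.2) / 3).
Proof.
rewrite inE /= => two /triangle_det.
set p := A2.1 - A1.1; set q := A2.2 - A1.2.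
set r := A3.1 - A1.1; set s := A3.2 - A1.2.
set D := p * s - r * q => D0.
case=> /(on_median_eq two) e1 /(on_median_eq two) e2 /(on_median_eq two) e3.
(* [f2] and [f3] say that [A1 A2 G] and [A1 G A3] each have a third of the signed area; each is a
   difference of two median equations. *)
have f2 : 3 * (p * (G.2 - A1.2) - q * (G.1 - A1.1)) = D.
  apply/eqP; rewrite -subr_eq0 -[X in _ == X](subrr 0) -{1}e1 -e2.
  by apply/eqP; rewrite /D /p /q /r /s; ring.
have f3 : 3 * (s * (G.1 - A1.1) - r * (G.2 - A1.2)) = D.
  apply/eqP; rewrite -subr_eq0 -[X in _ == X](subrr 0) -{1}e3 -e1.
  by apply/eqP; rewrite /D /p /q /r /s; ring.
have three : 3 != 0 :> F.
  by apply: contraNneq D0 => t0; rewrite -f2 t0 mul0r.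
split=> //.
(* Cramer's rule: in [D * p + D * r], rewriting the first [D] by [f3] and the second by [f2] cancels
   [G.2]. *)
have g1 : 3 * (G.1 - A1.1) = p + r.
  apply: (mulfI D0); by rewrite [RHS]mulrDr -{2}f3 -{2}f2 /D; ring.
have g2 : 3 * (G.2 - A1.2) = q + s.
  apply: (mulfI D0); by rewrite [RHS]mulrDr -{2}f3 -{2}f2 /D; ring.
rewrite [LHS]surjective_pairing; congr (_, _); apply: (mulfI three).
  transitivity (3 * (G.1 - A1.1) + 3 * A1.1); first by ring.
  by rewrite g1 /p /r; field.
transitivity (3 * (G.2 - A1.2) + 3 * A1.2); first by ring.
by rewrite g2 /q /s; field.
Qed.

(** Sides of the medial triangle are halved and reversed, so its determinant is a quarter of the
    original one. *)
Lemma medial_triangle (F : fieldType) (A1 A2 A3 : point F) :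
  2 \notin [pchar F] -> triangle A1 A2 A3 ->
  triangle (midpoint A2 A3) (midpoint A1 A3) (midpoint A1 A2).
Proof.
rewrite inE /= => two /triangle_det D0; apply/triangle_det => /=.
apply: contraNneq D0 => e; rewrite -[X in _ == X](mulr0 (2 * 2)) -e.
by apply/eqP; field.
Qed.

Theorem theorem20 (F : fieldType) (F_not_char2 : 2%N \notin [pchar F])
    (A1 A2 A3 : point F) (A_triangle : triangle A1 A2 A3)
    (O_g C_g N_g G : point F)
    (O_gP : is_green_orthocenter A1 A2 A3 O_g)
    (C_gP : is_green_circumcenter A1 A2 A3 C_g)
    (N_gP : is_green_nine_point_center A1 A2 A3 N_g)
    (GP : is_centroid A1 A2 A3 G) :
  (exists l : line F,
      [/\ on_line O_g l, on_line N_g l, on_line G l & on_line C_g l]) /\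
  N_g = midpoint O_g C_g /\
  G = affine_comb (1 / 3) O_g (2 / 3) C_g /\
  G = affine_comb (1 / 3) C_g (2 / 3) N_g.
Proof.
have two : 2 != 0 :> F by move: F_not_char2; rewrite inE.
have [three eG] := centroidE F_not_char2 A_triangle GP.
have D0 := (triangle_det A1 A2 A3).1 A_triangle.
have M_triangle := medial_triangle F_not_char2 A_triangle.
have E0 := (triangle_det _ _ _).1 M_triangle.
have eO := (green_orthocenterE O_g A_triangle).1 O_gP.
have eC := (green_circumcenterE C_g F_not_char2 A_triangle).1 C_gP.
have eN : N_g = midpoint O_g C_g.
  rewrite ((green_circumcenterE N_g F_not_char2 M_triangle).1 N_gP) eO eC.
  by move: E0; rewrite /midpoint /affine_comb /= => E0;
    congr (_, _); field; rewrite ?two ?D0 ?E0.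
have eG1 : G = affine_comb (1 / 3) O_g (2 / 3) C_g.
  by rewrite eG eO eC; congr (_, _) => /=; field; rewrite three D0.
have eG2 : G = affine_comb (1 / 3) C_g (2 / 3) N_g.
  by rewrite eG1 eN; congr (_, _) => /=; field; rewrite ?two ?three.
do !split=> //.
(* [N_g] and [G] are affine combinations of [O_g] and [C_g], so any line through these two contains
   them. *)
have [l [hO hC]] := line_through_exists O_g C_g.
exists l; split=> //; [rewrite eN | rewrite eG1];
  by apply: on_line_affine_comb => //; field.
Qed.
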